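(* $f(2,d)=d$ for every integer $d\ge 5$.
   Context: All graphs are finite, undirected and simple. A graph is $k$-connected if it has more than $k$ vertices and remains connected after deleting any set of fewer than $k$ vertices. For $F\subseteq E(G)$, $G-F$ denotes the graph obtained from $G$ by deleting the edges in $F$ (keeping all vertices). A matching $M$ (a possibly empty set of pairwise disjoint edges) of a $k$-connected graph $G$ is $k$-removable if $G-M$ is $k$-connected. An $m$-matching is a matching of size $m$. For integers $\delta>k\ge 1$, $f(k,\delta)$ denotes the largest integer $m$ such that every $k$-connected graph $G$ with $|V(G)|\ge 2\delta$ and minimum degree $\delta(G)\ge\delta$ has a $k$-removable $m$-matching. *)

(* Defs.v *)
From HB Require Import structures.
From mathcomp Require Import all_boot.
Set Implicit Arguments.
Unset Strict Implicit.
Unset Printing Implicit Defensive.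

Record sgraph := SGraph {
  vertex :> finType;
  adj : rel vertex;
  adj_sym : symmetric adj;
  adj_irr : irreflexive adj
}.

Section Graph.

Variable G : sgraph.

Definition edges : {set {set G}} :=
  [set e | [exists x, exists y, adj x y && (e == [set x; y])]].

Definition degree (x : G) : nat := #|[set y | adj x y]|.

(* Degrees are smaller than #|G|, so the default value #|G| does not affect
   the minimum as soon as G is nonempty. *)
Definition min_degree : nat := \big[minn/#|G|]_(x : G) degree x.

Definition connected : bool := [forall x : G, forall y : G, connect (@adj G) x y].

End Graph.

Section Deletion.

Variable G : sgraph.

Section DelVertices.

Variable S : {set G}.

Definition del_vertices_adj : rel {x : G | x \notin S} :=
  [rel x y | adj (val x) (val y)].

Fact del_vertices_sym : symmetric del_vertices_adj.
Proof. by move=> x y; apply: adj_sym. Qed.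

Fact del_vertices_irr : irreflexive del_vertices_adj.
Proof. by move=> x; apply: adj_irr. Qed.

Definition del_vertices : sgraph := SGraph del_vertices_sym del_vertices_irr.

End DelVertices.

Section DelEdges.

Variable F : {set {set G}}.

Definition del_edges_adj : rel G :=
  [rel x y | adj x y && ([set x; y] \notin F)].

Fact del_edges_sym : symmetric del_edges_adj.
Proof. by move=> x y; rewrite /del_edges_adj /= adj_sym setUC. Qed.

Fact del_edges_irr : irreflexive del_edges_adj.
Proof. by move=> x; rewrite /del_edges_adj /= adj_irr. Qed.

Definition del_edges : sgraph := SGraph del_edges_sym del_edges_irr.

End DelEdges.

End Deletion.

Definition k_connected (k : nat) (G : sgraph) : bool :=
  (k < #|G|) &&
  [forall S : {set G}, (#|S| < k) ==> connected (del_vertices S)].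

Definition matching (G : sgraph) (M : {set {set G}}) : bool :=
  (M \subset edges G) && trivIset M.

Definition removable (k : nat) (G : sgraph) (M : {set {set G}}) : bool :=
  matching M && k_connected k (del_edges M).

Definition forces_removable (k d m : nat) : Prop :=
  forall G : sgraph,
    k_connected k G -> 2 * d <= #|G| -> d <= min_degree G ->
    exists M : {set {set G}}, removable k M /\ #|M| = m.

(* f(k, d) = m, as a relation: m is the largest integer with the property
   (an m-matching has m >= 0, so natural numbers suffice). The notation f(k, d)
   is only meant for d > k >= 1. *)
Definition f_eq (k d m : nat) : Prop :=
  forces_removable k d m /\
  (forall m' : nat, forces_removable k d m' -> m' <= m).

(* Main.v *)
(** The upper bound is the complete graph on [2 d] vertices.  For the lower
    bound, a removable matching [M] with fewer than [d] edges is enlarged.  Put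
    [H = G - M] and call an edge [xy] of [H] critical if [H - xy] is not
    2-connected, that is, if for some vertex [t] it is the only edge of [H - t]
    between two complementary sides.

    If [M] cannot be enlarged, then edges between unmatched vertices are
    critical.  If moreover [u x] and [v y] are non-critical with [u <> v]
    unmatched and [xy] in [M], then replacing [xy] by [ux] and [vy] in [M]
    destroys 2-connectivity only if a separation has [x], [y] on one side and
    [u], [v] on the other one, crossed by [ux] and [vy] alone; so neither [uy]
    nor [vx] is an edge.  Hence any two unmatched vertices have together at
    most [2 |M|] non-critical edges, and critical edges exist.  A minimal side
    of a critical edge has at least [d - 1] vertices and, together with its cut
    vertex, contains no critical edge.  Two disjoint minimal sides [A] and [C]
    then leave no slack: counting matched vertices determines [M] up to a few
    configurations, according to which of [A] and [C] contain unmatched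
    vertices, and each of these admits an exchange as above or contains a cycle
    of critical edges, which is impossible. *)
Require Import Defs.
From mathcomp Require Import all_boot.
From mathcomp Require Import zify.
Set Implicit Arguments.
Unset Strict Implicit.
Unset Printing Implicit Defensive.

(** * Separations crossed by a single edge *)

Section Separations.

Variables (V : finType) (e : rel V).

Definition cross (P : {set V}) (t p q : V) : bool :=
  [&& p \in P, q \notin P, q != t & e p q].

(** 2-connectivity in terms of cuts: after deleting any vertex t, two nonempty parts of the
    remaining vertices are joined by an edge. For more than two vertices this is the usual notion,
    see [k_connected2E]. *)
Definition conn2 : bool :=
  [forall P : {set V}, forall t, forall x, forall y,
    [&& t \notin P, x \in P, y \notin P & y != t] ==>
    [exists p, exists q, cross P t p q]].

(** Under [conn2], xy is a bridge of the graph without t, and P is the side of it that contains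
    x. *)
Definition frag (P : {set V}) (t x y : V) : bool :=
  [&& t \notin P, cross P t x y &
      [forall p, forall q, cross P t p q ==> (p == x) && (q == y)]].

Definition crit (x y : V) : bool := [exists P, exists t, frag P t x y].

Definition nbr (x : V) : {set V} := [set y | e x y].

Definition opp (P : {set V}) (t : V) : {set V} := ~: (t |: P).

Lemma in_opp (P : {set V}) t x : (x \in opp P t) = (x != t) && (x \notin P).
Proof. by rewrite !inE negb_or. Qed.

Lemma conn2P :
  reflect (forall (P : {set V}) t x y, t \notin P -> x \in P -> y \notin P -> y != t ->
             exists p q, [/\ p \in P, q \notin P, q != t & e p q]) conn2.
Proof.
apply: (iffP idP) => [H P t x y tP xP yP yt | H].
  move/forallP/(_ P)/forallP/(_ t)/forallP/(_ x)/forallP/(_ y): H.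
  rewrite tP xP yP yt => /existsP [p /existsP [q /and4P [? ? ? ?]]].
  by exists p, q.
apply/forallP => P; apply/forallP => t; apply/forallP => x; apply/forallP => y.
apply/implyP => /and4P [tP xP yP yt].
have [p [q [pP qP qt epq]]] := H P t x y tP xP yP yt.
by apply/existsP; exists p; apply/existsP; exists q; apply/and4P.
Qed.

Lemma fragP (P : {set V}) t x y :
  reflect ([/\ t \notin P, x \in P, y \notin P, y != t & e x y] /\
           forall p q, p \in P -> q \notin P -> q != t -> e p q ->
             p = x /\ q = y) (frag P t x y).
Proof.
apply: (iffP and3P) => [[tP /and4P [xP yP yt exy] /forallP H] | [[tP xP yP yt exy] H]].
  split=> // p q pP qP qt epq.
  by move: (H p) => /forallP/(_ q); rewrite /cross pP qP qt epq /= => /andP [/eqP-> /eqP->].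
split=> //; first by apply/and4P.
apply/forallP => p; apply/forallP => q; apply/implyP => /and4P [pP qP qt epq].
by have [-> ->] := H p q pP qP qt epq; rewrite !eqxx.
Qed.

Hypothesis eC : symmetric e.
Hypothesis eI : irreflexive e.

Lemma frag_opp P t x y : frag P t x y -> frag (opp P t) t y x.
Proof.
move=> /fragP [[tP xP yP yt exy] H]; apply/fragP; split.
  rewrite !in_opp eqxx xP yt yP eC exy andbF; split=> //.
  by apply: contraNneq tP => <-.
move=> p q; rewrite !in_opp negb_and !negbK => /andP [pt pP] /orP [/eqP-> /eqP //|qP] _ epq.
by have [-> ->] := H q p qP pP pt (etrans (eC _ _) epq).
Qed.

Lemma critC x y : crit x y = crit y x.
Proof.
suff sub u v : crit u v -> crit v u by apply/idP/idP; apply: sub.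
move=> /existsP [P /existsP [t /frag_opp f]].
by apply/existsP; exists (opp P t); apply/existsP; exists t.
Qed.

Lemma frag_crit P t x y : frag P t x y -> crit x y.
Proof. by move=> f; apply/existsP; exists P; apply/existsP; exists t. Qed.

Hypothesis c2 : conn2.
Hypothesis deg3 : forall x, 2 < #|nbr x|.

Lemma not_nbr_sub2 x (y z : V) : ~ (forall w, e x w -> w = y \/ w = z).
Proof.
move=> H; have: nbr x \subset [set y; z].
  by apply/subsetP => w; rewrite !inE => /H [] ->; rewrite eqxx ?orbT.
by move/subset_leq_card/(leq_trans (deg3 x)); rewrite cards2; case: (y != z).
Qed.

Lemma cut_in (X : {set V}) x z :
  x \in X -> z \notin X ->
  (forall p q, p \in X -> q \notin X -> e p q -> p = x) -> X = [set x].
Proof.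
move=> xX zX H; apply/setP => w; rewrite inE; apply/idP/eqP => [wX|->//].
apply/eqP; apply/negPn/negP => wx.
have [||||p [q []]] := conn2P c2 (X :\ x) x w z; rewrite ?inE ?eqxx ?wx ?(negPf zX) ?andbF //.
  by apply: contraNneq zX => ->.
rewrite negb_and negbK => /andP [px pX] /orP [->//|qX] _ epq.
by rewrite (H p q) ?eqxx in px.
Qed.

Lemma cut_out (X : {set V}) y w z :
  w \in X -> y \notin X -> z \notin X -> z != y ->
  exists p q, [/\ p \in X, q \notin X, q != y & e p q].
Proof. by move=> wX yX zX zy; apply: (conn2P c2 X y w z). Qed.

(** * Shrinking a side along a critical edge *)

Section Shrink.

Variables (A : {set V}) (s a b : V).
Hypothesis fA : frag A s a b.

Lemma frag_out p q : p \in A -> q \notin A -> e p q -> q = s \/ (p = a /\ q = b).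
Proof.
move=> pA qA epq; have [->|qs] := eqVneq q s; first by left.
by right; have [_ /(_ p q pA qA qs epq)] := fragP _ _ _ _ fA.
Qed.

(** The part of P beyond A would need an exit other than s. It cannot be ab, as b is not in P; so it
    would cross P and have to be xy, whose ends lie in [s |: A]. *)
Lemma frag_shrink_near P t x y :
  frag P t x y -> x \in s |: A -> y \in s |: A -> t \in s |: A -> b \notin P ->
  P \proper A.
Proof.
move=> /fragP [[tP xP yP yt exy] HP] xAs yAs tAs bP.
have [[sA aA bA bs eab] _] := fragP _ _ _ _ fA.
have oppA z : z \in opp A s -> z \notin s |: A by rewrite in_opp !inE negb_or.
have noB w : w \in opp A s -> w \notin P.
  move=> wB; apply/negP => wP.
  have [|||//|p [q []]] := @cut_out (P :&: opp A s) s w b.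
  - by rewrite !inE wP; move: wB; rewrite !inE.
  - by rewrite in_setI in_opp eqxx andbF.
  - by rewrite in_setI (negPf bP).
  rewrite in_setI => /andP [pP pB]; rewrite in_setI negb_and => H qs epq.
  have qA : q \notin A.
    apply/negP => qA; have pA : p \notin A by move: pB; rewrite in_opp => /andP [].
    case: (frag_out qA pA (etrans (eC _ _) epq)) => [ps|[_ pb]].
      by move: pB; rewrite in_opp ps eqxx.
    by rewrite -pb pP in bP.
  have qB : q \in opp A s by rewrite in_opp qs qA.
  rewrite qB orbF in H.
  have qt : q != t by apply: contraTneq tAs => <-; apply: oppA.
  have [px _] := HP p q pP H qt epq.
  by move: (oppA _ pB); rewrite px xAs.
(* No vertex beyond A is in P, so with s in P every edge from s to the far side would cross P. Then
   s has no neighbour there, and b cuts off the rest of the far side, nonempty by the degree of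
   b. *)
have sP : s \notin P.
  apply/negP => sP.
  have [w [ebw wa ws]] : exists w, [/\ e b w, w != a & w != s].
    have /set0Pn [w] : nbr b :\: [set a; s] != set0.
      rewrite setD_eq0; apply/negP => /subset_leq_card/(leq_trans (deg3 b)).
      by rewrite cards2; case: (a != s).
    by rewrite !inE negb_or => /andP [/andP [wa ws] ebw]; exists w.
  have wB : w \in opp A s.
    rewrite in_opp ws; apply/negP => wA.
    case: (frag_out wA bA); first by rewrite eC.
      by move=> E; rewrite E eqxx in bs.
    by move=> [E _]; rewrite E eqxx in wa.
  have wb : w != b by apply: contraTneq ebw => ->; rewrite eI.
  have [||||p [q []]] := @cut_out (opp A s :\ b) b w a.
  - by rewrite in_setD1 wb wB.
  - by rewrite !inE eqxx.
  - by rewrite !inE aA !orbT andbF.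
  - by apply: contraNneq bA => <-.
  rewrite in_setD1 => /andP [pb pB]; rewrite in_setD1 negb_and negbK => H qb epq.
  move: H; rewrite (negPf qb) in_opp /= negb_and !negbK => /orP [/eqP qs|qA].
    have pt : p != t by apply: contraTneq tAs => <-; apply: oppA.
    rewrite qs eC in epq; have [_ py] := HP s p sP (noB _ pB) pt epq.
    by move: (oppA _ pB); rewrite py yAs.
  have pA : p \notin A by move: pB; rewrite in_opp => /andP [].
  case: (frag_out qA pA (etrans (eC _ _) epq)) => [ps|[_ E]].
    by move: pB; rewrite in_opp ps eqxx.
  by rewrite E eqxx in pb.
have PA : P \subset A.
  apply/subsetP => z zP; apply/negPn/negP => zA.
  have zs : z != s by apply: contraNneq sP => <-.
  by move: (noB z); rewrite in_opp zs zA zP => /(_ isT).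
rewrite properE PA; apply/negP => AP.
move: yAs tAs; rewrite !inE => /orP [/eqP ys|/(subsetP AP)]; last by rewrite (negPf yP).
by move=> /orP [/eqP ts|/(subsetP AP)]; rewrite ?(negPf tP) // ys ts eqxx in yt *.
Qed.

(** The only edges leaving [P :&: A] are xy and ab. If a is not in P, this makes y a cut vertex; if
    x = a, it makes [P :&: A] a single vertex of degree at most 2. Otherwise a takes over from t as
    the cut vertex of a side without a. *)
Lemma frag_shrink_far P t x y :
  frag P t x y -> x \in s |: A -> y \in s |: A -> t \notin s |: A -> s \notin P ->
  exists A' t', frag A' t' x y /\ A' \proper A.
Proof.
move=> /fragP [[tP xP yP yt exy] HP] xAs yAs tAs sP.
have [[sA aA bA bs eab] _] := fragP _ _ _ _ fA.
have xA : x \in A by move: xAs; rewrite !inE => /orP [/eqP E|//]; rewrite -E xP in sP.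
have by_ : b != y.
  by apply: contraTneq yAs => <-; rewrite !inE negb_or bs bA.
have st : s != t by apply: contraNneq tAs => <-; rewrite !inE eqxx.
have out p q : p \in P :&: A -> q \notin P :&: A -> e p q ->
    (p = x /\ q = y) \/ (p = a /\ q = b).
  rewrite !in_setI => /andP [pP pA]; rewrite negb_and => H epq.
  case: (boolP (q \in A)) => qA.
    rewrite qA orbF in H; left; apply: HP => //.
    by apply: contraNneq tAs => <-; rewrite !inE qA orbT.
  case: (frag_out pA qA epq) => [qs|]; last by right.
  by left; apply: HP; rewrite // qs.
have xX : x \in P :&: A by rewrite inE xP xA.
have bX : b \notin P :&: A by rewrite inE (negPf bA) andbF.
have yX : y \notin P :&: A by rewrite inE (negPf yP).
case: (boolP (a \in P)) => aP; last first.
  have [p [q [pX qX qy epq]]] := cut_out xX yX bX by_.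
  case: (out p q pX qX epq) => [[_ E]|[E _]]; first by rewrite E eqxx in qy.
  by move: pX; rewrite E inE (negPf aP).
have [xa|xa] := eqVneq x a.
  have X1 : P :&: A = [set x].
    by apply: (cut_in xX bX) => p q pX qX /(out p q pX qX) [[]|[]] // ->.
  exfalso; apply: (@not_nbr_sub2 x y b) => w exw.
  case: (boolP (w \in P :&: A)) => wX.
    by move: wX; rewrite X1 inE => /eqP E; rewrite E eI in exw.
  by case: (out x w xX wX exw) => [[_ ->]|[_ ->]]; [left|right].
exists ((P :&: A) :\ a), a; split.
  apply/fragP; split.
    rewrite !inE eqxx xa xP xA (negPf yP) exy !andbF; split=> //.
    by apply: contraNneq yP => ->.
  move=> p q; rewrite in_setD1 => /andP [pa pX]; rewrite in_setD1 negb_and negbK => H qa epq.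
  rewrite (negPf qa) /= in H.
  by case: (out p q pX H epq) => [|[E _]] //; rewrite E eqxx in pa.
apply/properP; split; first by apply/subsetP => z; rewrite !inE => /and3P [].
by exists a => //; rewrite !inE eqxx.
Qed.

(** One of the two sides of the separation suits the preceding lemmas: the one missing b if t is in
    [s |: A], the one missing s otherwise. *)
Lemma frag_shrink x y :
  crit x y -> x \in s |: A -> y \in s |: A ->
  exists A' t', (frag A' t' x y \/ frag A' t' y x) /\ A' \proper A.
Proof.
move=> /existsP [P /existsP [t f]] xAs yAs; have f' := frag_opp f.
case: (boolP (t \in s |: A)) => tAs.
  case: (boolP (b \in P)) => bP.
    exists (opp P t), t; split; first by right.
    by apply: (frag_shrink_near f') => //; rewrite in_opp bP andbF.
  by exists P, t; split; [left|apply: (frag_shrink_near f)].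
case: (boolP (s \in P)) => sP; last first.
  have [A' [t' [f1 p1]]] := frag_shrink_far f xAs yAs tAs sP.
  by exists A', t'; split=> //; left.
have [|A' [t' [f1 p1]]] := frag_shrink_far f' yAs xAs tAs.
  by rewrite in_opp sP andbF.
by exists A', t'; split=> //; right.
Qed.

End Shrink.
(* A separation whose edge lies in [W] and whose side is smallest could be
   shrunk, along the next edge of [W] at the end inside that side. *)
Lemma crit_forest (W : {set V}) :
  W != set0 ->
  exists2 w, w \in W & #|[set v in W | e w v && crit w v]| <= 1.
Proof.
move=> /set0Pn [w0 w0W].
case: (boolP [exists w in W, #|[set v in W | e w v && crit w v]| <= 1]).
  by move=> /exists_inP [w wW H]; exists w.
rewrite negb_exists_in => /forall_inP H; exfalso.
have next w v : w \in W -> exists z, [/\ z \in W, z != v & crit w z].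
  move=> wW; have: [set v in W | e w v && crit w v] :\ v != set0.
    rewrite setD_eq0; apply/negP => /subset_leq_card; rewrite cards1.
    by apply/negP/H.
  by move=> /set0Pn [z]; rewrite !inE => /and4P [zv zW _ cz]; exists z.
suff none n (A : {set V}) s a b : #|A| < n -> a \in W -> b \in W -> ~ frag A s a b.
  have [z [zW _ /existsP [A /existsP [s f]]]] := next w0 w0 w0W.
  exact: (none _ A s w0 z (ltnSn _)).
elim: n A s a b => // n IHn A s a b An aW bW fA.
have [z [zW zb cz]] := next a b aW.
have [[sA aA _ _ _] _] := fragP _ _ _ _ fA.
have eaz : e a z by move: cz => /existsP [P /existsP [t /fragP [[]]]].
have zAs : z \in s |: A.
  rewrite !inE; case: (boolP (z \in A)) => zA; first by rewrite orbT.
  by case: (frag_out fA aA zA eaz) => [->|[_ E]]; [rewrite eqxx|rewrite E eqxx in zb].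
have [|A' [t' [f' /proper_card lt]]] := frag_shrink fA cz _ zAs.
  by rewrite !inE aA orbT.
by case: f'; apply: IHn => //; apply: leq_trans lt _.
Qed.

(** * Sizes of sides and pairs of minimal sides *)

Lemma frag_inner (A : {set V}) s a b : frag A s a b -> exists2 v, v \in A & v != a.
Proof.
move=> fA; have [[_ aA _ _ _] _] := fragP _ _ _ _ fA.
have /set0Pn [w] : nbr a :\: [set s; b] != set0.
  rewrite setD_eq0; apply/negP => /subset_leq_card/(leq_trans (deg3 a)).
  by rewrite cards2; case: (s != b).
rewrite !inE negb_or => /andP [/andP [ws wb] eaw].
exists w; last by apply: contraTneq eaw => ->; rewrite eI.
apply/negPn/negP => wA; case: (frag_out fA aA wA eaw) => [E|[_ E]].
  by rewrite E eqxx in ws.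
by rewrite E eqxx in wb.
Qed.

Lemma frag_nbr_sub (A : {set V}) s a b v :
  frag A s a b -> v \in A -> v != a -> nbr v \subset (s |: A) :\ v.
Proof.
move=> fA vA va; apply/subsetP => w; rewrite !inE => evw; apply/andP; split.
  by apply: contraTneq evw => ->; rewrite eI.
case: (boolP (w \in A)) => wA; first by rewrite orbT.
case: (frag_out fA vA wA evw) => [->|[E _]]; first by rewrite eqxx.
by rewrite E eqxx in va.
Qed.

Lemma card_setU1D1 (A : {set V}) s v : s \notin A -> v \in A -> #|(s |: A) :\ v| = #|A|.
Proof.
move=> sA vA; have := cardsD1 v (s |: A).
by rewrite cardsU1 sA !inE vA orbT /= !add1n => -[].
Qed.

Lemma frag_card (A : {set V}) s a b k :
  (forall x, k <= #|nbr x|) -> frag A s a b -> k <= #|A|.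
Proof.
move=> degk fA; have [v vA va] := frag_inner fA.
have [[sA _ _ _ _] _] := fragP _ _ _ _ fA.
rewrite -(card_setU1D1 sA vA); apply: leq_trans (degk v) _.
exact: subset_leq_card (frag_nbr_sub fA vA va).
Qed.

Lemma frag_full (A : {set V}) s a b k v :
  (forall x, k <= #|nbr x|) -> frag A s a b -> #|A| <= k ->
  v \in A -> v != a -> nbr v = (s |: A) :\ v.
Proof.
move=> degk fA Ak vA va; have [[sA _ _ _ _] _] := fragP _ _ _ _ fA.
apply/eqP; rewrite eqEcard (frag_nbr_sub fA vA va) card_setU1D1 //.
exact: leq_trans Ak (degk v).
Qed.

(** This is all that later arguments keep of the minimality of two sides. The cut vertices s and r
    may coincide; each lies outside both sides. *)
Definition end_pair (A : {set V}) s a b (C : {set V}) r c d : Prop :=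
  [/\ frag A s a b, frag C r c d, A \subset opp C r, C \subset opp A s &
      (forall x y, x \in s |: A -> y \in s |: A -> ~~ crit x y) /\
      (forall x y, x \in r |: C -> y \in r |: C -> ~~ crit x y)].

Lemma end_pair_sym A s a b C r c d :
  end_pair A s a b C r c d -> end_pair C r c d A s a b.
Proof. by case=> ? ? ? ? []. Qed.

(** A is a minimal side and C a minimal side inside the opposite side of A; [frag_shrink] then
    excludes critical edges. What remains is that r is not in A. *)
Lemma exists_end_pair x y : crit x y ->
  exists A s a b C r c d, end_pair A s a b C r c d.
Proof.
pose sides := fun P : {set V} => [exists t, exists x, exists y, frag P t x y].
have sidesI P t u v : frag P t u v -> sides P.
  by move=> f; apply/existsP; exists t; apply/existsP; exists u; apply/existsP; exists v.
have noncrit P t u v : minset sides P -> frag P t u v ->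
    forall p q, p \in t |: P -> q \in t |: P -> ~~ crit p q.
  move=> /minsetP [_ mP] f p q pP qP; apply/negP => cpq.
  have [P' [t' [f' /properP [sub [w wP]]]]] := frag_shrink f cpq pP qP.
  by rewrite (mP P') ?wP //; case: f' => /sidesI.
move=> /existsP [P0 /existsP [t0 /sidesI/minset_exists [A mA _]]].
have /minsetP [/existsP [s /existsP [a /existsP [b fA]]] _] := mA.
have /sidesI/minset_exists [C mC CB] := frag_opp fA.
have /minsetP [/existsP [r /existsP [c /existsP [d fC]]] minC] := mC.
exists A, s, a, b, C, r, c, d; split=> //; last first.
  by split; [apply: noncrit mA fA|apply: noncrit mC fC].
have AC z : z \in A -> z \notin C.
  by move=> zA; apply/negP => /(subsetP CB); rewrite in_opp zA andbF.
have [[sA aA bA bs eab] _] := fragP _ _ _ _ fA.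
have [[rC cC dC dr ecd] _] := fragP _ _ _ _ fC.
apply/subsetP => z zA; rewrite in_opp (AC _ zA) andbT.
apply: contraTneq zA => ->; apply/negP => rA.
(* As c is not a cut vertex, some p in C other than c is joined to r. With r in A this edge can only
   be ab, so p = b is the only neighbour of r in C. *)
have [v vC vc] := frag_inner fC.
have [||||p [q []]] := @cut_out (C :\ c) c v d.
- by rewrite !inE vc vC.
- by rewrite !inE eqxx.
- by rewrite !inE (negPf dC) andbF.
- by apply: contraNneq dC => ->.
rewrite !inE negb_and negbK => /andP [pc pC] /orP [/eqP->|qC]; first by rewrite eqxx.
move=> _ epq; case: (frag_out fC pC qC epq) => [E|[E _]]; last by rewrite E eqxx in pc.
subst q; have /(subsetP CB) := pC; rewrite in_opp => /andP [ps pA].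
have rout p' : p' \in C -> e p' r -> p' = b.
  move=> /(subsetP CB); rewrite in_opp => /andP [ps' pA'] ep.
  case: (frag_out fA rA pA' (etrans (eC _ _) ep)) => [E|[_ //]].
  by rewrite E eqxx in ps'.
have pb := rout p pC epq; subst b.
(* Then p can replace r as the cut vertex, which makes [C :\ p] a smaller side. *)
have fCp : frag (C :\ p) p c d.
  apply/fragP; split.
    rewrite !inE eqxx (eq_sym c) pc cC (negPf dC) ecd andbF; split=> //.
    by apply: contraNneq dC => ->.
  move=> p' q'; rewrite !inE negb_and negbK => /andP [pp' pC'] H q'p epq'.
  rewrite (negPf q'p) /= in H.
  case: (frag_out fC pC' H epq') => [E|//]; subst q'.
  by rewrite (rout _ pC' epq') eqxx in pp'.
have := minC _ (sidesI _ _ _ _ fCp) (subD1set _ _).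
by move=> E; move: pC; rewrite -E !inE eqxx.
Qed.

End Separations.

(** * Matchings that cannot be enlarged *)

Section NoAugmentation.

Variables (V : finType) (e : rel V) (pi : V -> V) (k : nat).

Definition matched : {set V} := [set x | pi x != x].

Definition noncrit_nbr (u : V) : {set V} := [set w | e u w && ~~ crit e u w].

Hypothesis eC : symmetric e.
Hypothesis eI : irreflexive e.
Hypothesis c2 : conn2 e.
Hypothesis piK : involutive pi.
Hypothesis pie : forall x, e x (pi x) = false.
Hypothesis k5 : 4 < k.
Hypothesis deg_ge : forall x, k <= #|nbr e x| + (x \in matched).
Hypothesis matched_le : #|matched|.+2 <= k.*2.
Hypothesis V_ge : k.*2 <= #|V|.
Hypothesis edge_crit : forall u v,
  u \notin matched -> v \notin matched -> e u v -> crit e u v.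
(** A failed exchange: trading the matching edge from x to [pi x] for ux and the edge from v to
    [pi x] enlarges the matching, so 2-connectivity is lost, and P and t witness this. *)
Hypothesis swap_sep : forall u v x,
  u \notin matched -> v \notin matched -> u != v ->
  x \in noncrit_nbr u -> pi x \in noncrit_nbr v ->
  exists (P : {set V}) t, [/\ t \notin P, x \in P /\ pi x \in P, u \notin P /\ v \notin P,
    u != t /\ v != t & forall p q, p \in P -> q \notin P -> q != t -> e p q ->
      (p = x /\ q = u) \/ (p = pi x /\ q = v)].

(** * Failed exchanges and non-critical neighbours *)

Lemma deg_pred x : k.-1 <= #|nbr e x|.
Proof. by have := deg_ge x; case: (x \in matched); lia. Qed.

Lemma deg_unmatched x : x \notin matched -> k <= #|nbr e x|.
Proof. by move=> xU; have := deg_ge x; rewrite (negPf xU) addn0. Qed.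

Lemma deg_gt2 x : 2 < #|nbr e x|.
Proof. by apply: leq_trans (deg_pred x); lia. Qed.

Lemma pi_matched x : (pi x \in matched) = (x \in matched).
Proof. by rewrite !inE piK eq_sym. Qed.

Lemma noncrit_matched u : u \notin matched -> noncrit_nbr u \subset matched.
Proof.
move=> uU; apply/subsetP => w; rewrite inE => /andP [euw].
by apply: contraNT => wU; apply: edge_crit.
Qed.

Lemma noncritE u w : w \in noncrit_nbr u -> e u w.
Proof. by rewrite inE => /andP []. Qed.

(** The edge would run from [pi x] in P to u outside P, as a third crossing edge. *)
Lemma no_third_edge u v x :
  u \notin matched -> v \notin matched -> u != v ->
  x \in noncrit_nbr u -> pi x \in noncrit_nbr v -> ~ e u (pi x).
Proof.
move=> uU vU uv xu xv eux.
have xM := subsetP (noncrit_matched uU) _ xu.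
have [P [t [_ [_ piP] [uP _] [ut _] H]]] := swap_sep uU vU uv xu xv.
case: (H (pi x) u piP uP ut (etrans (eC _ _) eux)) => -[E E'].
  by move: xM; rewrite inE E eqxx.
by rewrite E' eqxx in uv.
Qed.

(** A common neighbour of v and [pi x] other than t gives a third crossing edge, whichever side it
    lies on; so t is the only candidate. *)
Lemma no_common_nbrs u v x w1 w2 :
  u \notin matched -> v \notin matched -> u != v ->
  x \in noncrit_nbr u -> pi x \in noncrit_nbr v ->
  w1 != w2 -> e v w1 -> e v w2 -> e (pi x) w1 -> e (pi x) w2 -> False.
Proof.
move=> uU vU uv xu xv w12 v1 v2 x1 x2.
have xM := subsetP (noncrit_matched uU) _ xu.
have [P [t [_ [_ piP] [_ vP] [_ vt] H]]] := swap_sep uU vU uv xu xv.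
have no w : e v w -> e (pi x) w -> w = t.
  move=> vw xw; apply/eqP/negPn/negP => wt.
  case: (boolP (w \in P)) => wP.
    case: (H w v wP vP vt (etrans (eC _ _) vw)) => -[E1 E2].
      by rewrite E2 eqxx in uv.
    by rewrite E1 eI in xw.
  case: (H (pi x) w piP wP wt xw) => -[E1 E2].
    by move: xM; rewrite inE E1 eqxx.
  by rewrite E2 eI in vw.
by move: w12; rewrite (no w1) // (no w2) // eqxx.
Qed.

(** By [no_third_edge], the union of the two neighbourhoods and the partners of their intersection
    are disjoint; both consist of matched vertices. *)
Lemma card_noncrit u v :
  u \notin matched -> v \notin matched -> u != v ->
  #|noncrit_nbr u| + #|noncrit_nbr v| <= #|matched|.
Proof.
move=> uU vU uv; rewrite -cardsUI.
set I := _ :&: _; set J := _ :|: _.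
have <- : #|pi @: I| = #|I| by apply: card_imset; apply: inv_inj.
have -> : #|J| + #|pi @: I| = #|J :|: pi @: I|.
  suff dis : J :&: pi @: I = set0 by rewrite -cardsUI dis cards0 addn0.
  apply/eqP; rewrite setI_eq0 disjoint_sym; apply/pred0P => z; apply/negP.
  move=> /andP [/= /imsetP [x]]; rewrite inE => /andP [xu xv] ->.
  have vu : v != u by rewrite eq_sym.
  rewrite inE => /orP [pu|pv].
    have := @no_third_edge u v (pi x) uU vU uv pu.
    by rewrite piK => /(_ xv); apply; apply: noncritE.
  have := @no_third_edge v u (pi x) vU uU vu pv.
  by rewrite piK => /(_ xu); apply; apply: noncritE.
apply: subset_leq_card; rewrite !subUset !noncrit_matched //.
apply/subsetP => z /imsetP [x]; rewrite inE => /andP [xu _] ->.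
by rewrite pi_matched (subsetP (noncrit_matched uU)).
Qed.

(** Equality in the count makes [noncrit_nbr v] and the partners of [noncrit_nbr u], disjoint by
    assumption, fill up [matched]. *)
Lemma noncrit_partner u v w :
  u \notin matched -> v \notin matched ->
  #|matched| <= #|noncrit_nbr u| + #|noncrit_nbr v| ->
  (forall x, x \in noncrit_nbr u -> pi x \in noncrit_nbr v -> False) ->
  w \in matched -> w \notin noncrit_nbr v -> pi w \in noncrit_nbr u.
Proof.
move=> uU vU le no wM wv.
have E : noncrit_nbr v :|: pi @: noncrit_nbr u = matched.
  apply/eqP; rewrite eqEcard; apply/andP; split.
    rewrite subUset noncrit_matched //=; apply/subsetP => z /imsetP [x xu ->].
    by rewrite pi_matched (subsetP (noncrit_matched uU)).
  suff dis : noncrit_nbr v :&: pi @: noncrit_nbr u = set0.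
    rewrite -(leq_add2r #|set0 : {set V}|) -{2}dis cardsUI cards0 addn0 addnC.
    by rewrite card_imset //; apply: inv_inj.
  apply/eqP; rewrite setI_eq0 disjoint_sym; apply/pred0P => z; apply/negP.
  by move=> /andP [/= /imsetP [x xu ->]]; apply: no xu.
move: wM; rewrite -E inE (negPf wv) => /imsetP [x xu ->].
by rewrite piK.
Qed.

(** * One side of an end pair *)

Section Ends.

Variables (A : {set V}) (s a b : V) (C : {set V}) (r c d : V).
Hypothesis ends : end_pair e A s a b C r c d.

Lemma end_frag : frag e A s a b. Proof. by case: ends. Qed.

Lemma end_sub w : w \in A -> w \notin r |: C.
Proof.
case: ends => _ _ /subsetP AC _ _ /AC.
by rewrite in_opp !inE negb_or.
Qed.

Lemma end_sub_r w : w \in C -> w \notin s |: A.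
Proof.
case: ends => _ _ _ /subsetP CA _ /CA.
by rewrite in_opp !inE negb_or.
Qed.

Lemma end_noncrit x y : x \in s |: A -> y \in s |: A -> ~~ crit e x y.
Proof. by case: ends => _ _ _ _ [H _]; apply: H. Qed.

Lemma end_full v : #|A| <= k.-1 -> v \in A -> v != a -> nbr e v = (s |: A) :\ v.
Proof. exact: (frag_full eI deg_pred end_frag). Qed.

Lemma end_card : k.-1 <= #|A|.
Proof. exact: (frag_card eI deg_gt2 deg_pred end_frag). Qed.

Lemma end_noncrit_sub u : u \in A -> noncrit_nbr u \subset s |: A.
Proof.
move=> uA; apply/subsetP => w; rewrite !inE => /andP [euw ncr].
case: (boolP (w \in A)) => wA; first by rewrite orbT.
case: (frag_out end_frag uA wA euw) => [->|[E1 E2]]; first by rewrite eqxx.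
by rewrite E1 E2 (frag_crit end_frag) in ncr.
Qed.

(** Edges at u stay in [s |: A], where none is critical, except ab, which concerns only u = a. *)
Lemma end_noncrit_card u :
  u \in A -> u \notin matched -> k.-1 <= #|noncrit_nbr u| /\
    (u != a -> k <= #|noncrit_nbr u|).
Proof.
move=> uA uU.
have sub w : e u w -> w \notin noncrit_nbr u -> u = a /\ w = b.
  move=> euw; rewrite inE euw /= negbK => cuw.
  have uAs : u \in s |: A by rewrite inE uA orbT.
  have wAs : w \notin s |: A by apply: contraTN cuw; apply: end_noncrit.
  have wA : w \notin A by apply: contraNN wAs => wA; rewrite inE wA orbT.
  case: (frag_out end_frag uA wA euw) => // ws.
  by rewrite ws !inE eqxx in wAs.
have deg := deg_unmatched uU; split=> [|ua]; last first.
  apply: leq_trans deg (subset_leq_card _); apply/subsetP => w; rewrite inE => euw.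
  by apply: contraNT ua => /(sub w euw) [-> _].
have : #|nbr e u| <= #|b |: noncrit_nbr u|.
  apply: subset_leq_card; apply/subsetP => w; rewrite in_setU1 inE => euw.
  by case: (boolP (w \in noncrit_nbr u)) => [|/(sub w euw) [_ ->]]; rewrite ?orbT ?eqxx.
by rewrite cardsU1; move: deg; case: (b \notin _); clear; lia.
Qed.

(** Such a v has at most k - 1 neighbours, too few for an unmatched vertex. It is joined to all the
    rest of [s |: A], whereas its partner is not a neighbour. *)
Lemma end_full_partner v : #|A| <= k.-1 -> v \in A -> v != a ->
  v \in matched /\ pi v \notin s |: A.
Proof.
move=> Ak vA va; have N := end_full Ak vA va.
have [[sA _ _ _ _] _] := fragP _ _ _ _ _ end_frag.
have vM : v \in matched.
  apply/negPn/negP => /deg_unmatched; rewrite N card_setU1D1 //; move: Ak k5; clear; lia.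
split=> //; apply/negP => pA.
have : pi v \in nbr e v by rewrite N in_setD1 pA andbT; rewrite inE in vM.
by rewrite inE pie.
Qed.

Lemma end_full_partnerN v : #|A| <= k.-1 -> A \subset matched -> v \in A -> pi v \notin A.
Proof.
move=> Ak AM vA; apply/negP => pvA.
have vM := subsetP AM v vA.
have [va|va] := eqVneq v a; last first.
  by have [_] := end_full_partner Ak vA va; rewrite inE pvA orbT.
have pva : pi v != a by move: vM; rewrite inE -va.
by have [_] := end_full_partner Ak pvA pva; rewrite piK inE vA orbT.
Qed.

(** Any two vertices of A besides a and v will do; there are two because #|A| >= k - 1 >= 4. *)
Lemma end_common_nbrs v : #|A| <= k.-1 -> v \in A -> v != a ->
  exists w1 w2, [/\ w1 != w2, e s w1 /\ e s w2 & e v w1 /\ e v w2].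
Proof.
move=> Ak vA va.
have : 1 < #|A :\ a :\ v|.
  have := cardsD1 v (A :\ a); have := cardsD1 a A; have := end_card.
  have [[_ aA _ _ _] _] := fragP _ _ _ _ _ end_frag.
  by rewrite aA in_setD1 va vA /=; move: k5; clear; lia.
move=> /card_gt1P [w1 [w2 [W1 W2 w12]]].
have nb w : w \in A :\ a :\ v -> e s w /\ e v w.
  rewrite !inE => /and3P [wv wa wA].
  have N := end_full Ak wA wa.
  have [[sA _ _ _ _] _] := fragP _ _ _ _ _ end_frag.
  have ws : w != s by apply: contraNneq sA => <-.
  have : s \in nbr e w by rewrite N !inE eqxx eq_sym ws.
  have : v \in nbr e w by rewrite N !inE eq_sym wv vA orbT.
  by rewrite !inE ![e w _]eC.
by exists w1, w2; split=> //; split; case: (nb _ W1); case: (nb _ W2).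
Qed.

(* Cutting the edge from [x] to [a] leaves [A] plus [s] connected. *)
Lemma end_cut_vertex (P : {set V}) t x y :
  a \notin P -> c \notin P -> a != t -> x \in P -> x \in s |: A -> y \in r |: C ->
  (forall p q, p \in P -> q \notin P -> q != t -> e p q ->
      (p = x /\ q = a) \/ (p = y /\ q = c)) ->
  t \in s |: A.
Proof.
move=> aP cP at_ xP xAs yC H; apply/negPn/negP => tAs.
have [[sA aA bA bs eab] _] := fragP _ _ _ _ _ end_frag.
have cA : c \notin s |: A.
  by apply: end_sub_r; case: ends => _ /fragP [[]].
have yA : y \notin A by apply: contraTN yC; apply: end_sub.
have st : s != t by apply: contraNneq tAs => <-; rewrite !inE eqxx.
case: (boolP (s \in P)) => sP; last first.
  have xA : x \in A by move: xAs; rewrite !inE => /orP [/eqP E|//]; rewrite -E xP in sP.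
  (* If s is not in P, edges leaving [P :&: A] can only end at a, which would make a a cut
     vertex. *)
  have [||||p [q []]] := cut_out c2 (X := P :&: A) (y := a) (w := x) (z := b).
  - by rewrite inE xP.
  - by rewrite inE (negPf aP).
  - by rewrite inE (negPf bA) andbF.
  - by apply: contraNneq bA => ->.
  rewrite !inE negb_and => /andP [pP pA] qX qa epq.
  have no : q \notin P -> q != t -> False.
    move=> qP qt; case: (H p q pP qP qt epq) => -[E1 E2].
      by rewrite E2 eqxx in qa.
    by rewrite -E1 pA in yA.
  case: (boolP (q \in A)) => qA.
    rewrite qA orbF in qX; apply: no => //.
    by apply: contraNneq tAs => <-; rewrite !inE qA orbT.
  case: (frag_out end_frag pA qA epq) => [E|[E _]]; first by apply: no; rewrite E.
  by rewrite E (negPf aP) in pP.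
(* Here s is in P, so edges leaving [A :\: P] can only go from a to x or b. Hence this set is a
   alone, and a has degree at most 2. *)
have out p q : p \in A :\: P -> q \notin A :\: P -> e p q -> p = a /\ (q = x \/ q = b).
  rewrite !inE negb_and negbK => /andP [pP pA] qX epq.
  have pt : p != t by apply: contraNneq tAs => <-; rewrite !inE pA orbT.
  have yes : q \in P -> p = a /\ (q = x \/ q = b).
    move=> qP; case: (H q p qP pP pt (etrans (eC _ _) epq)) => -[-> E]; first by split; [|left].
    by move: cA; rewrite -E inE pA orbT.
  case: (boolP (q \in A)) => qA; first by rewrite qA orbF in qX; apply: yes.
  case: (frag_out end_frag pA qA epq) => [E|[-> ->]]; first by apply: yes; rewrite E.
  by split; [|right].
have aX : a \in A :\: P by rewrite inE aP.
have bX : b \notin A :\: P by rewrite inE (negPf bA) andbF.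
have X1 : A :\: P = [set a].
  by apply: (cut_in c2 aX bX) => p q pX qX /(out p q pX qX) [].
apply: (not_nbr_sub2 deg_gt2 (x := a) (y := x) (z := b)) => w eaw.
case: (boolP (w \in A :\: P)) => wX.
  by move: wX; rewrite X1 inE => /eqP E; rewrite E eI in eaw.
by have [] := out a w aX wX eaw.
Qed.

End Ends.

(** * Excluding every end pair *)

(** Edges inside W are critical, and by [crit_forest] some vertex of W has at most one of them. With
    three possible neighbours outside, its degree is at most 4, less than k. *)
Lemma few_outside_nbrs (W : {set V}) z1 z2 z3 :
  W != set0 -> (forall w, w \in W -> w \notin matched) ->
  (forall w z, w \in W -> e w z -> z \in W \/ z \in [set z1; z2; z3]) -> False.
Proof.
move=> W0 WU H; have [w wW] := crit_forest eC eI c2 deg_gt2 W0.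
set X := [set v in W | _] => X1; have := deg_unmatched (WU w wW).
have /subset_leq_card : nbr e w \subset X :|: [set z1; z2; z3].
  apply/subsetP => z; rewrite inE => ewz; rewrite in_setU.
  case: (H w z wW ewz) => [zW|->]; last by rewrite orbT.
  by rewrite inE zW ewz edge_crit // WU.
have := (leq_card_setU X [set z1; z2; z3]).1.
have : #|[set z1; z2; z3]| <= 3.
  by apply: leq_trans (leq_card_setU _ _).1 _; rewrite cards1 cards2; case: (z1 != z2).
move: X1 k5; clear; lia.
Qed.

(** By [end_cut_vertex] on both sides, the cut vertex t of the failed exchange at a and c lies in
    both enlarged sides, so t = r. *)
Lemma ends_transversal A s a b C r c d x :
  end_pair e A s a b C r c d -> a \notin matched -> c \notin matched ->
  x \in noncrit_nbr a -> pi x \in noncrit_nbr c -> False.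
Proof.
move=> E; have E' := end_pair_sym E.
have [fA fC _ _ _] := E.
have [[sA aA bA bs eab] _] := fragP _ _ _ _ _ fA.
have [[rC cC dC dr ecd] _] := fragP _ _ _ _ _ fC.
move=> aM cM xa yc.
have ac : a != c.
  by apply: contraTneq cC => <-; have := end_sub E aA; rewrite inE negb_or => /andP [].
have [P [t [tP [xP yP] [aP cP] [at_ ct] H]]] := swap_sep aM cM ac xa yc.
have xA := subsetP (end_noncrit_sub E aA) _ xa.
have yC := subsetP (end_noncrit_sub E' cC) _ yc.
have tA := end_cut_vertex E aP cP at_ xP xA yC H.
have tC : t \in r |: C.
  apply: (end_cut_vertex E' cP aP ct yP yC xA) => p q pP qP qt epq.
  by case: (H p q pP qP qt epq); [right|left].
have tr : t = r.
  move: tC; rewrite inE => /orP [/set1P //|tC].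
  by have := end_sub_r E tC; rewrite tA.
have yCC : pi x \in C.
  by move: yC; rewrite inE => /orP [/set1P E0|//]; rewrite tr -E0 yP in tP.
(* Now [P :&: C] is a side with cut vertex r whose edge joins [pi x] to c, although this edge is
   non-critical. *)
have : crit e (pi x) c.
  apply: (@frag_crit _ _ (P :&: C) r); apply/fragP; split.
    rewrite !inE (negPf rC) (negPf cP) yP yCC andbF; split=> //; first by rewrite -tr.
    by rewrite eC noncritE.
  move=> p q; rewrite !inE negb_and => /andP [pP pC] qX qr epq.
  have qC : q \in C.
    apply/negPn/negP => qC; case: (frag_out fC pC qC epq) => [E0|[E0 _]].
      by rewrite E0 eqxx in qr.
    by rewrite E0 (negPf cP) in pP.
  rewrite qC orbF in qX; rewrite -tr in qr.
  case: (H p q pP qX qr epq) => // -[E1 _].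
  by move: xA; rewrite -E1 (negPf (end_sub_r E pC)).
by move: yc; rewrite inE critC // => /andP [_ /negPf ->].
Qed.

(** Both non-critical neighbourhoods have at least k - 1 elements, and together at most #|matched|
    <= 2k - 2. So there is no slack, and a and c are the only unmatched vertices of A and C. *)
Lemma ends_both A s a b C r c d u v :
  end_pair e A s a b C r c d -> u \in A -> u \notin matched ->
  v \in C -> v \notin matched -> False.
Proof.
move=> E uA uM vC vM; have E' := end_pair_sym E.
have [fA fC _ _ _] := E.
have [[sA aA bA bs eab] _] := fragP _ _ _ _ _ fA.
have [[rC cC dC dr ecd] _] := fragP _ _ _ _ _ fC.
have AC w : w \in A -> w \notin C.
  by move=> /(end_sub E); rewrite inE negb_or => /andP [].
have eq_ends u' v' : u' \in A -> u' \notin matched -> v' \in C -> v' \notin matched ->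
    [/\ u' = a, v' = c, #|noncrit_nbr u'| = k.-1, #|noncrit_nbr v'| = k.-1 &
        #|matched| = (k.-1).*2].
  move=> uA' uM' vC' vM'.
  have uv : u' != v' by apply: contraTneq vC' => <-; apply: AC.
  have le := card_noncrit uM' vM' uv.
  have [u1 u2] := end_noncrit_card E uA' uM'.
  have [v1 v2] := end_noncrit_card E' vC' vM'.
  have ua : u' = a.
    by apply/eqP/negPn/negP => /u2; move: le v1 matched_le; clear; lia.
  have va : v' = c.
    by apply/eqP/negPn/negP => /v2; move: le u1 matched_le; clear; lia.
  by split=> //; move: le u1 v1 matched_le; clear; lia.
have [ua vc na nc cM] := eq_ends u v uA uM vC vM; subst u v.
have AM w : w \in A -> w != a -> w \in matched.
  by move=> wA; apply: contraNT => wM; have [->] := eq_ends w c wA wM vC vM.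
have CM w : w \in C -> w != c -> w \in matched.
  by move=> wC; apply: contraNT => wM; have [_ ->] := eq_ends a w uA uM wC wM.
have nA := end_noncrit_sub E uA; have nC := end_noncrit_sub E' vC.
have noT x : x \in noncrit_nbr a -> pi x \in noncrit_nbr c -> False.
  by apply: (ends_transversal E).
have le : #|matched| <= #|noncrit_nbr a| + #|noncrit_nbr c| by rewrite na nc cM addnn.
have parA w : w \in A -> w != a -> pi w \in noncrit_nbr a.
  move=> wA wa; apply: (noncrit_partner uM vM le noT (AM w wA wa)).
  by apply/negP => /(subsetP nC); apply/negP; apply: (end_sub E).
have parC w : w \in C -> w != c -> pi w \in noncrit_nbr c.
  move=> wC wc; apply: (noncrit_partner vM uM _ _ (CM w wC wc)); first by rewrite addnC.
    move=> x xc xa; apply: (noT (pi x)) => //; by rewrite piK.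
  by apply/negP => /(subsetP nA); apply/negP; apply: (end_sub_r E).
(* If A had only k - 1 vertices, the partners of those other than a would lie outside [s |: A],
   which contains [noncrit_nbr a]. *)
have Ak : k <= #|A|.
  rewrite leqNgt; apply/negP => lt; have le' : #|A| <= k.-1 by rewrite -ltnS (ltn_predK k5).
  have [w wA wa] := frag_inner eI deg_gt2 fA.
  have [_] := end_full_partner E le' wA wa.
  by rewrite (subsetP nA _ (parA w wA wa)).
have Ck : k <= #|C|.
  rewrite leqNgt; apply/negP => lt; have le' : #|C| <= k.-1 by rewrite -ltnS (ltn_predK k5).
  have [w wC wc] := frag_inner eI deg_gt2 fC.
  have [_] := end_full_partner E' le' wC wc.
  by rewrite (subsetP nC _ (parC w wC wc)).
have cA1 := cardsD1 a A; have cC1 := cardsD1 c C; rewrite uA vC in cA1 cC1.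
have dis : (A :\ a) :&: (C :\ c) = set0.
  apply/setP => w; rewrite !inE; apply/negP => /andP [/andP [_ /AC wC] /andP [_ wC']].
  by rewrite wC' in wC.
have cU : #|(A :\ a) :|: (C :\ c)| = #|A :\ a| + #|C :\ c|.
  by rewrite -cardsUI dis cards0 addn0.
have subM : (A :\ a) :|: (C :\ c) \subset matched.
  by apply/subsetP => w; rewrite in_setU !in_setD1 => /orP [] /andP [wn wX]; auto.
have eqM : (A :\ a) :|: (C :\ c) = matched.
  by apply/eqP; rewrite eqEcard subM cM cU; move: cA1 cC1 Ak Ck; clear; lia.
have := subset_leq_card subM; rewrite cM cU => cle.
have sM : s \notin matched.
  rewrite -eqM !inE (negPf sA) andbF /=; apply/negP => /andP [_ sC].
  by have := end_sub_r E sC; rewrite !inE eqxx.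
have nE : noncrit_nbr a = A :\ a.
  apply/eqP; rewrite eqEcard na; apply/andP; split; last by move: cle cA1 cC1 Ak Ck; clear; lia.
  apply/subsetP => w wa.
  have wM := subsetP (noncrit_matched uM) _ wa.
  have := subsetP nA _ wa; rewrite !inE => /orP [/eqP ws|wA].
    by rewrite -ws wM in sM.
  by rewrite wA andbT; apply: contraNneq uM => <-.
(* Since a is no cut vertex, s has a neighbour p in A other than a. Exchanging the matching edge at
   p for those from a to [pi p] and from s to p contradicts [no_third_edge], as a is also joined to
   p. *)
have [w wA wa] := frag_inner eI deg_gt2 fA.
have [||||p [q []]] := cut_out c2 (X := A :\ a) (y := a) (w := w) (z := b).
- by rewrite !inE wa.
- by rewrite !inE eqxx.
- by rewrite !inE (negPf bA) andbF.
- by apply: contraNneq bA => ->.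
rewrite !inE negb_and negbK => /andP [pa pA] qX qa epq.
rewrite (negPf qa) /= in qX.
case: (frag_out fA pA qX epq) => [qs|[E0 _]]; last by rewrite E0 eqxx in pa.
subst q; have pn : p \in noncrit_nbr a by rewrite nE !inE pa.
have ps : p \in noncrit_nbr s.
  by rewrite inE eC epq /=; apply: (end_noncrit E); rewrite !inE ?eqxx ?pA ?orbT.
have sa : a != s by apply: contraNneq sA => <-.
have := @no_third_edge a s (pi p) uM sM sa (parA p pA pa).
by rewrite piK => /(_ ps); apply; apply: noncritE.
Qed.

Lemma unmatched_card : 1 < #|~: matched|.
Proof. by have := cardsC matched; move: V_ge matched_le; clear; lia. Qed.

Lemma unmatched_neq x0 : ~: matched :\ x0 != set0.
Proof.
apply/eqP => E; have := cardsD1 x0 (~: matched); rewrite E cards0.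
by move: unmatched_card; case: (x0 \in _); clear; lia.
Qed.

(** C and [noncrit_nbr u] are disjoint sets of matched vertices with at least k - 1 elements each;
    so they exhaust [matched], C has k - 1 vertices and u = a. *)
Lemma ends_one A s a b C r c d u :
  end_pair e A s a b C r c d -> u \in A -> u \notin matched ->
  C \subset matched -> False.
Proof.
move=> E uA uM CM; have E' := end_pair_sym E.
have [fA fC _ _ _] := E.
have [[sA aA bA bs eab] _] := fragP _ _ _ _ _ fA.
have [[rC cC dC dr ecd] _] := fragP _ _ _ _ _ fC.
have eqs u' : u' \in A -> u' \notin matched ->
    [/\ u' = a, #|C| <= k.-1 & C :|: noncrit_nbr u' = matched].
  move=> uA' uM'; have [u1 u2] := end_noncrit_card E uA' uM'.
  have Cc := end_card E'; have nA := end_noncrit_sub E uA'.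
  have dis : C :&: noncrit_nbr u' = set0.
    apply/setP => w; rewrite in_setI in_set0; apply/negP => /andP [wC /(subsetP nA)].
    by apply/negP; apply: (end_sub_r E).
  have cU : #|C :|: noncrit_nbr u'| = #|C| + #|noncrit_nbr u'|.
    by rewrite -cardsUI dis cards0 addn0.
  have sub : C :|: noncrit_nbr u' \subset matched by rewrite subUset CM noncrit_matched.
  have := subset_leq_card sub; rewrite cU => le.
  have ua : u' = a by apply/eqP/negPn/negP => /u2; move: le Cc matched_le; clear; lia.
  split=> //; first by move: le u1 matched_le; clear; lia.
  by apply/eqP; rewrite eqEcard sub cU; move: u1 Cc matched_le; clear; lia.
have [ua Ck EM] := eqs u uA uM; subst u.
have nA := end_noncrit_sub E uA.
have [c1 c1C c1c] := frag_inner eI deg_gt2 fC.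
have rA : r \notin A by apply/negP => /(end_sub E); rewrite !inE eqxx.
(* For r unmatched, exchange the matching edge at c1: the partner of c1 is a non-critical neighbour
   of a, while c1 and r have two common neighbours. *)
case: (boolP (r \in matched)) => rM; last first.
  have ar : a != r by apply: contraNneq rA => <-.
  have [w1 [w2 [w12 [r1 r2] [v1 v2]]]] := end_common_nbrs E' Ck c1C c1c.
  apply: (@no_common_nbrs a r (pi c1) w1 w2) => //; rewrite ?piK //.
    have : pi c1 \in matched by rewrite pi_matched (subsetP CM).
    rewrite -EM inE => /orP [|//].
    by rewrite (negPf (end_full_partnerN E' Ck CM c1C)).
  have ncr : ~~ crit e r c1 by apply: (end_noncrit E'); rewrite !inE ?eqxx ?c1C ?orbT.
  have : r \in nbr e c1.
    by rewrite (end_full E' Ck c1C c1c) !inE eqxx andbT; apply: contraNneq rC => ->.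
  by rewrite !inE ncr andbT eC.
have rs : r = s.
  move: rM; rewrite -EM inE (negPf rC) => /(subsetP nA).
  by rewrite inE (negPf rA) orbF => /set1P.
(* Now r = s, and the unmatched vertices other than a have no neighbours outside their own set but
   a, c and s. *)
subst r; apply: (@few_outside_nbrs (~: matched :\ a) a c s).
- exact: unmatched_neq.
- by move=> w; rewrite in_setD1 in_setC => /andP [].
move=> w z; rewrite !in_setD1 !in_setC => /andP [wa wM] ewz.
have wA : w \notin A by apply: contraNN wa => wA; have [->] := eqs w wA wM.
have wC : w \notin C by apply: contraNN wM => /(subsetP CM).
case: (boolP (z \in matched)) => zM; last first.
  by have [->|za] := eqVneq z a; [right; rewrite !inE eqxx|left].
right; have ws : w != s by apply: contraNneq wM => ->.
move: zM; rewrite -EM inE => /orP [zC|/(subsetP nA)].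
  case: (frag_out fC zC wC (etrans (eC _ _) ewz)) => [E0|[-> _]].
    by rewrite E0 eqxx in ws.
  by rewrite !inE eqxx orbT.
rewrite inE => /orP [/set1P ->|zA]; first by rewrite !inE eqxx !orbT.
case: (frag_out fA zA wA (etrans (eC _ _) ewz)) => [E0|[-> _]].
  by rewrite E0 eqxx in ws.
by rewrite !inE eqxx.
Qed.

(** By counting, A and C have k - 1 vertices each and make up [matched]; so r and s are
    unmatched. *)
Lemma ends_none A s a b C r c d :
  end_pair e A s a b C r c d -> A \subset matched -> C \subset matched -> False.
Proof.
move=> E AM CM; have E' := end_pair_sym E.
have [fA fC _ _ _] := E.
have [[sA aA bA bs eab] _] := fragP _ _ _ _ _ fA.
have [[rC cC dC dr ecd] _] := fragP _ _ _ _ _ fC.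
have Ac := end_card E; have Cc := end_card E'.
have dis : A :&: C = set0.
  apply/setP => w; rewrite in_setI in_set0; apply/negP => /andP [/(end_sub E)].
  by rewrite inE negb_or => /andP [_ /negPf ->].
have cU : #|A :|: C| = #|A| + #|C| by rewrite -cardsUI dis cards0 addn0.
have sub : A :|: C \subset matched by rewrite subUset AM CM.
have := subset_leq_card sub; rewrite cU => le.
have EM : A :|: C = matched.
  by apply/eqP; rewrite eqEcard sub cU; move: Ac Cc matched_le; clear; lia.
have Ak : #|A| <= k.-1 by move: le Cc matched_le; clear; lia.
have Ck : #|C| <= k.-1 by move: le Ac matched_le; clear; lia.
have sM : s \notin matched.
  rewrite -EM inE (negPf sA) /=; apply/negP => sC.
  by have := end_sub_r E sC; rewrite !inE eqxx.
have rM : r \notin matched.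
  rewrite -EM inE (negPf rC) orbF; apply/negP => rA.
  by have := end_sub E rA; rewrite !inE eqxx.
have [rs|rs] := eqVneq r s.
  subst r; apply: (@few_outside_nbrs (~: matched :\ s) a c s).
  - exact: unmatched_neq.
  - by move=> w; rewrite in_setD1 in_setC => /andP [].
  move=> w z; rewrite !in_setD1 !in_setC => /andP [ws wM] ewz.
  case: (boolP (z \in matched)) => zM; last first.
    by have [->|zs] := eqVneq z s; [right; rewrite !inE eqxx !orbT|left].
  right; have wA : w \notin A by apply: contraNN wM => /(subsetP AM).
  have wC : w \notin C by apply: contraNN wM => /(subsetP CM).
  move: zM; rewrite -EM inE => /orP [zA|zC].
    case: (frag_out fA zA wA (etrans (eC _ _) ewz)) => [E0|[-> _]].
      by rewrite E0 eqxx in ws.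
    by rewrite !inE eqxx.
  case: (frag_out fC zC wC (etrans (eC _ _) ewz)) => [E0|[-> _]].
    by rewrite E0 eqxx in ws.
  by rewrite !inE eqxx orbT.
have nb B t x y D q p o v : end_pair e B t x y D q p o -> #|B| <= k.-1 ->
    v \in B -> v != x -> v \in noncrit_nbr t.
  move=> F Bk vB vx; rewrite inE (end_noncrit F) ?inE ?eqxx ?vB ?orbT // andbT.
  have [[tB _ _ _ _] _] := fragP _ _ _ _ _ (end_frag F).
  have : t \in nbr e v.
    by rewrite (end_full F Bk vB vx) !inE eqxx andbT; apply: contraNneq tB => ->.
  by rewrite inE eC.
(* If r and s differ, take a1 in A other than a with partner other than c. The exchange joining s to
   a1 and r to [pi a1] contradicts [no_common_nbrs], since s and a1 have two common neighbours. *)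
have /set0Pn [a1] : A :\ a :\ pi c != set0.
  apply/eqP => E0; have := cardsD1 (pi c) (A :\ a); have := cardsD1 a A.
  by rewrite E0 cards0 aA; case: (_ \in _); move: Ac k5; clear; lia.
rewrite !inE => /and3P [a1c a1a a1A].
have c1C : pi a1 \in C.
  have : pi a1 \in matched by rewrite pi_matched (subsetP AM).
  by rewrite -EM inE (negPf (end_full_partnerN E Ak AM a1A)).
have c1c : pi a1 != c by apply: contraNneq a1c => <-; rewrite piK.
have [w1 [w2 [w12 [r1 r2] [v1 v2]]]] := end_common_nbrs E Ak a1A a1a.
apply: (@no_common_nbrs r s (pi a1) w1 w2) => //; rewrite ?piK //.
  exact: (nb _ _ _ _ _ _ _ _ _ E').
exact: (nb _ _ _ _ _ _ _ _ _ E).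
Qed.

Lemma not_augmentable_absurd : False.
Proof.
(* Without critical edges, two unmatched vertices would violate [card_noncrit] by their degrees
   alone. *)
have [x [y cxy]] : exists x y, crit e x y.
  have /card_gt1P [u [v [uM vM uv]]] := unmatched_card; rewrite !in_setC in uM vM.
  case: (boolP [exists x, exists y, crit e x y]) => [/existsP [x /existsP [y]]|H].
    by exists x, y.
  have full w : w \notin matched -> k <= #|noncrit_nbr w|.
    move=> wM; apply: leq_trans (deg_unmatched wM) (subset_leq_card _).
    apply/subsetP => z; rewrite !inE => -> /=; apply: contraNN H => cr.
    by apply/existsP; exists w; apply/existsP; exists z.
  have := card_noncrit uM vM uv; have := full u uM; have := full v vM.
  by move: matched_le; clear; lia.
have [A [s [a [b [C [r [c [d E]]]]]]]] := exists_end_pair eC eI c2 deg_gt2 cxy.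
have E' := end_pair_sym E.
case: (boolP (A \subset matched)) => [AM|/subsetPn [u uA uM]];
case: (boolP (C \subset matched)) => [CM|/subsetPn [v vC vM]].
- exact: ends_none E AM CM.
- exact: ends_one E' vC vM AM.
- exact: ends_one E uA uM CM.
exact: ends_both E uA uM vC vM.
Qed.

End NoAugmentation.

(** * Graphs *)

Lemma set2_eq (T : finType) (p q u v : T) :
  [set p; q] = [set u; v] -> (p = u /\ q = v) \/ (p = v /\ q = u).
Proof.
move=> E; have pin : p \in [set u; v] by rewrite -E set21.
have qin : q \in [set u; v] by rewrite -E set22.
have uin : u \in [set p; q] by rewrite E set21.
have vin : v \in [set p; q] by rewrite E set22.
case/set2P: pin => ?; case/set2P: qin => ?; subst; auto.
  by move: vin; rewrite setUid => /set1P ->; left.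
by move: uin; rewrite setUid => /set1P ->; left.
Qed.

Lemma conn2PN (V : finType) (e : rel V) :
  ~~ conn2 e ->
  exists (P : {set V}) t x y, [/\ t \notin P, x \in P, y \notin P, y != t &
    forall p q, p \in P -> q \notin P -> q != t -> ~~ e p q].
Proof.
move=> /forallPn [P] /forallPn [t] /forallPn [x] /forallPn [y].
rewrite negb_imply => /andP [/and4P [tP xP yP yt] /existsPn H].
exists P, t, x, y; split=> // p q pP qP qt; apply/negP => epq.
by move: (H p) => /existsPn /(_ q); rewrite /cross pP qP qt epq.
Qed.

Lemma crit_of_cut (V : finType) (e : rel V) (P : {set V}) t x y u v :
  symmetric e -> conn2 e -> t \notin P -> x \in P -> y \notin P -> y != t ->
  (forall p q, p \in P -> q \notin P -> q != t -> e p q -> [set p; q] = [set u; v]) ->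
  crit e u v.
Proof.
move=> eC c2 tP xP yP yt H.
have [p [q [pP qP qt epq]]] := conn2P _ c2 _ _ _ _ tP xP yP yt.
suff : crit e p q.
  by case: (set2_eq (H p q pP qP qt epq)) => -[-> ->] //; rewrite critC.
apply: (@frag_crit _ _ P t); apply/fragP; split=> // p' q' pP' qP' qt' epq'.
have E := etrans (H p' q' pP' qP' qt' epq') (esym (H p q pP qP qt epq)).
by case/set2_eq: E => -[E1 E2] //; rewrite -E1 pP' in qP.
Qed.

Lemma k_connected2E (G : sgraph) :
  k_connected 2 G = (2 < #|G|) && conn2 (@adj G).
Proof.
rewrite /k_connected; case: (ltnP 2 #|G|) => //= G2.
have sC := @adj_sym G.
apply/forallP/conn2P => [H P t x y tP xP yP yt | H S].
  have := implyP (H [set t]); rewrite cards1 => /(_ isT)/forallP cn.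
  have xt : x \notin [set t] by rewrite inE; apply: contraNneq tP => <-.
  have yt' : y \notin [set t] by rewrite inE.
  have := cn (Sub x xt) => /forallP /(_ (Sub y yt')) co.
  case: (boolP [exists p, exists q, cross (@adj G) P t p q]).
    by move=> /existsP [p /existsP [q /and4P [? ? ? ?]]]; exists p, q.
  move=> no; move: yP; suff -> : (y \in P) = (x \in P) by rewrite xP.
  pose Q := [pred z : del_vertices [set t] | val z \in P].
  have cl : closed (@adj (del_vertices [set t])) Q.
    apply: intro_closed; first by apply/sym_connect_sym/adj_sym.
    move=> p q epq pP; apply: contraNT no => qP.
    apply/existsP; exists (val p); apply/existsP; exists (val q); apply/and4P; split=> //.
    by have := valP q; rewrite inE.
  by have := closed_connect cl co; rewrite !inE /= => ->.
apply/implyP => S2; apply/forallP => x; apply/forallP => y.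
(* For empty S a third vertex serves as t, which is where 2 < #|G| enters. The set P below is the
   component of x without t, and an edge leaving it would extend the component. *)
have [t [tx ty St]] : exists t, [/\ t != val x, t != val y & S \subset [set t]].
  have [E|] := eqVneq S set0.
    have /set0Pn [t] : ~: [set val x; val y] != set0.
      rewrite -card_gt0 -(ltn_add2l #|[set val x; val y]|) cardsC addn0 cards2.
      by apply: leq_ltn_trans G2; case: (_ != _).
    by rewrite !inE negb_or => /andP [? ?]; exists t; split; rewrite // E sub0set.
  move=> /set0Pn [t tS]; exists t; split.
  - by apply: contraTneq tS => ->; apply: (valP x).
  - by apply: contraTneq tS => ->; apply: (valP y).
  apply/subsetP => z zS; rewrite inE; apply/negPn/negP => zt.
  have : #|[set z; t]| <= #|S|.
    by apply: subset_leq_card; apply/subsetP => w /set2P [] ->.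
  by rewrite cards2 zt; lia.
pose C := [set z | connect (@adj (del_vertices S)) x z].
pose P := [set val z | z in C] :\ t.
apply/negPn/negP => no.
have xP : val x \in P by rewrite in_setD1 eq_sym tx; apply/imsetP; exists x; rewrite ?inE ?connect0.
have yP : val y \notin P.
  rewrite in_setD1 negb_and; apply/orP; right; apply/imsetP => -[z].
  by rewrite inE => cz /val_inj E; rewrite E cz in no.
have yt : val y != t by rewrite eq_sym.
have tP : t \notin P by rewrite !inE eqxx.
have [p [q [pP qP qt epq]]] := H P t _ _ tP xP yP yt.
move: pP; rewrite in_setD1 => /andP [pt /imsetP [p' pC Ep]].
have qS : q \notin S by apply: contraNN qt => /(subsetP St)/set1P ->.
move: qP; rewrite in_setD1 qt /= => /imsetP; apply; exists (Sub q qS : del_vertices S) => //.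
rewrite !inE in pC *; apply: connect_trans pC (connect1 _).
by rewrite /= /del_vertices_adj /= -Ep.
Qed.

Lemma edge_set2 (G : sgraph) (x y : G) : ([set x; y] \in edges G) = adj x y.
Proof.
rewrite inE; apply/existsP/idP => [[p /existsP [q /andP [pq /eqP E]]]|xy].
  by case: (set2_eq E) => -[-> ->] //; rewrite adj_sym.
by exists x; apply/existsP; exists y; rewrite xy eqxx.
Qed.

Lemma min_degree_le (G : sgraph) (x : G) : min_degree G <= degree x.
Proof.
rewrite /min_degree; have := mem_index_enum x.
elim: (index_enum _) => // z r IHr; rewrite inE big_cons geq_min.
by case/orP => [/eqP <-|/IHr ->]; rewrite ?leqnn ?orbT.
Qed.

(** * Enlarging a removable matching *)

Section Augment.

Variables (G : sgraph) (d : nat) (M : {set {set G}}).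
Hypothesis d5 : 4 < d.
Hypothesis G_ge : 2 * d <= #|G|.
Hypothesis deg_ge : d <= min_degree G.
Hypothesis remM : removable 2 M.
Hypothesis M_lt : #|M| < d.

Let e := del_edges_adj M.

Let ME : M \subset edges G. Proof. by case/andP: remM => /andP []. Qed.
Let MT : trivIset M. Proof. by case/andP: remM => /andP []. Qed.

Let eC : symmetric e. Proof. exact: del_edges_sym. Qed.
Let eI : irreflexive e. Proof. exact: del_edges_irr. Qed.
Let c2 : conn2 e.
Proof. by case/andP: remM => _; rewrite k_connected2E => /andP []. Qed.

Let mem_adj x y : [set x; y] \in M -> adj x y.
Proof. by move=> /(subsetP ME); rewrite edge_set2. Qed.

Let mem_neq x y : [set x; y] \in M -> x != y.
Proof. by move=> /mem_adj; apply: contraTneq => ->; rewrite adj_irr. Qed.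

(** By default an unmatched vertex is its own partner, so this is an involution that moves exactly
    the matched vertices. *)
Definition partner (x : G) : G := odflt x [pick y | [set x; y] \in M].

Let mem_uniq B B' x : B \in M -> B' \in M -> x \in B -> x \in B' -> B = B'.
Proof.
move=> BM BM' xB xB'; apply/eqP; apply: contraTT xB => nB.
move/trivIsetP: MT => /(_ B B' BM BM' nB); rewrite disjoint_sym => /disjointFr.
by move=> /(_ _ xB') ->.
Qed.

Let partnerP x y : [set x; y] \in M -> partner x = y.
Proof.
move=> xyM; rewrite /partner; case: pickP => [z xzM /=|/(_ y)]; last by rewrite xyM.
have := mem_uniq xyM xzM (set21 _ _) (set21 _ _).
by case/set2_eq => -[E1 E2]; rewrite E2 // -E1.
Qed.

Let partner_mem x : partner x != x -> [set x; partner x] \in M.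
Proof. by rewrite /partner; case: pickP => [//|_]; rewrite eqxx. Qed.

Let partnerK : involutive partner.
Proof.
move=> x; have [E|/partner_mem xM] := eqVneq (partner x) x; first by rewrite !E.
by apply: partnerP; rewrite setUC.
Qed.

Let mem_set2 B x : B \in M -> x \in B -> B = [set x; partner x] /\ x \in matched partner.
Proof.
move=> BM; have := subsetP ME B BM; rewrite inE.
move=> /existsP [p /existsP [q /andP [_ /eqP E]]]; subst B.
have qp : [set q; p] \in M by rewrite setUC.
have pq := mem_neq BM.
by move=> /set2P [] ->; rewrite ?inE (partnerP BM, partnerP qp) ?(setUC [set q]) // eq_sym.
Qed.

Let not_e_partner x : e x (partner x) = false.
Proof.
rewrite /e /del_edges_adj /=.
have [->|/partner_mem ->] := eqVneq (partner x) x; first by rewrite adj_irr.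
by rewrite andbF.
Qed.

Let nbr_ge x : d <= #|nbr e x| + (x \in matched partner).
Proof.
have dx : d <= degree x.
  by apply: leq_trans deg_ge _; apply: min_degree_le.
have sub : [set y | adj x y] \subset
    nbr e x :|: (if x \in matched partner then [set partner x] else set0).
  apply/subsetP => y; rewrite !inE => xy.
  rewrite /e /del_edges_adj /= xy /=; case: (boolP (_ \in M)) => //= xyM.
  by have := mem_neq xyM; rewrite (partnerP xyM) eq_sym => ->; rewrite inE.
apply: leq_trans dx _; apply: leq_trans (subset_leq_card sub) _.
apply: leq_trans (leq_card_setU _ _).1 _; rewrite leq_add2l.
by case: ifP => _; rewrite ?cards1 ?cards0.
Qed.

Let matched_le : #|matched partner|.+2 <= d.*2.
Proof.
have sub : matched partner \subset cover M.
  apply/subsetP => x; rewrite inE => /partner_mem xM.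
  by apply/bigcupP; exists [set x; partner x]; rewrite ?set21.
have : #|cover M| <= \sum_(B in M) 2.
  apply: leq_trans (leq_card_cover M).1 _; apply: leq_sum => B BM.
  have := subsetP ME B BM; rewrite inE.
  move=> /existsP [p /existsP [q /andP [_ /eqP ->]]].
  by rewrite cards2; case: (_ != _).
rewrite sum_nat_const; move: (subset_leq_card sub) M_lt; clear; lia.
Qed.

Hypothesis maxM : forall M' : {set {set G}},
  M' \subset edges G -> trivIset M' -> #|M'| = #|M|.+1 ->
  ~~ conn2 (del_edges_adj M').

Let M_add (M0 : {set {set G}}) x y : M0 \subset edges G -> trivIset M0 ->
  adj x y -> x \notin cover M0 -> y \notin cover M0 ->
  [/\ [set x; y] |: M0 \subset edges G, trivIset ([set x; y] |: M0) &
      #|[set x; y] |: M0| = #|M0|.+1].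
Proof.
move=> M0E M0T xy xM yM.
have nz B : B \in M0 -> [disjoint [set x; y] & B].
  move=> BM; rewrite disjoint_subset; apply/subsetP => z /set2P [] ->; apply/negP => zB.
    by case/negP: xM; apply/bigcupP; exists B.
  by case/negP: yM; apply/bigcupP; exists B.
have no0 : set0 \notin M0.
  apply/negP => /(subsetP M0E); rewrite inE => /existsP [p /existsP [q /andP [_ /eqP E]]].
  by have := set21 p q; rewrite -E inE.
have [T N] := trivIsetU1 nz M0T no0.
split=> //; last by rewrite cardsU1 N.
by rewrite subUset sub1set edge_set2 xy.
Qed.

Let matched_cover x : x \notin matched partner -> x \notin cover M.
Proof.
apply: contraNN => /bigcupP [B BM xB].
by have [_] := mem_set2 BM xB.
Qed.

Let e_adj x y : e x y -> adj x y. Proof. by case/andP. Qed.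

Let unmatched_crit u v :
  u \notin matched partner -> v \notin matched partner -> e u v -> crit e u v.
Proof.
move=> uU vU euv.
have [sub tr card] := M_add ME MT (e_adj euv) (matched_cover uU) (matched_cover vU).
have [P [t [x [y [tP xP yP yt H]]]]] := conn2PN (maxM sub tr card).
apply: (crit_of_cut eC c2 tP xP yP yt) => p q pP qP qt epq.
move: (H p q pP qP qt) epq; rewrite /e /del_edges_adj /= in_setU1 negb_or.
by case: (adj p q) => //=; rewrite negb_and negbK => /orP [/eqP //|/negPf ->].
Qed.

(** With z the partner of x, replacing xz by ux and vz gives a matching M' with one edge more, so by
    maximality some cut is crossed by no edge of G - M'. *)
Let swap_cut u v x :
  u \notin matched partner -> v \notin matched partner -> u != v ->
  x \in noncrit_nbr e u -> partner x \in noncrit_nbr e v ->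
  exists (P : {set G}) t, [/\ t \notin P, x \in P /\ partner x \in P,
    u \notin P /\ v \notin P, u != t /\ v != t &
    forall p q, p \in P -> q \notin P -> q != t -> e p q ->
      (p = x /\ q = u) \/ (p = partner x /\ q = v)].
Proof.
move=> uU vU uv xu yv; set z := partner x in yv *.
have xM : x \in matched partner.
  by move: xu; rewrite inE => /andP [exu]; apply: contraNT => xU; apply: unmatched_crit.
have zx : z != x by rewrite inE in xM.
have xzM : [set x; z] \in M by apply: partner_mem.
have eux : e u x by move: xu; rewrite inE => /andP [].
have evz : e v z by move: yv; rewrite inE => /andP [].
pose M0 := M :\ [set x; z].
have M0M : M0 \subset M by apply: subD1set.
have cov w : w \in cover M0 -> w \in cover M /\ w \notin [set x; z].
  move=> /bigcupP [B]; rewrite in_setD1 => /andP [Bn BM] wB; split.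
    by apply/bigcupP; exists B.
  by apply: contraNN Bn => w2; rewrite (mem_uniq BM xzM wB w2).
have uC := matched_cover uU; have vC := matched_cover vU.
have neq w w' : w \notin matched partner -> w' \in matched partner -> w != w'.
  by move=> wU; apply: contraTneq => <-.
have zM : z \in matched partner by rewrite inE partnerK eq_sym.
have [s1 t1 n1] : [/\ [set v; z] |: M0 \subset edges G, trivIset ([set v; z] |: M0) &
      #|[set v; z] |: M0| = #|M0|.+1].
  apply: M_add; rewrite ?(subset_trans M0M) ?(trivIsetS M0M) ?e_adj //.
    by apply: contraNN vC => /cov [].
  by apply/negP => /cov []; rewrite set22.
have [s2 t2 n2] : [/\ [set u; x] |: ([set v; z] |: M0) \subset edges G,
      trivIset ([set u; x] |: ([set v; z] |: M0)) &
      #|[set u; x] |: ([set v; z] |: M0)| = #|[set v; z] |: M0|.+1].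
  apply: M_add; rewrite ?e_adj //; rewrite /cover bigcup_setU big_set1 inE negb_or -/(cover M0).
    by rewrite !inE negb_or uv neq //=; apply: contraNN uC => /cov [].
  rewrite !inE negb_or eq_sym neq // eq_sym zx /=; apply/negP => /cov [].
  by rewrite set21.
set M' := _ |: _ in s2 t2 n2.
have n : #|M'| = #|M|.+1 by rewrite n2 n1 (cardsD1 [set x; z] M) xzM.
have [P [t [p0 [q0 [tP pP qP qt H]]]]] := conn2PN (maxM s2 t2 n).
have xz' : del_edges_adj M' x z.
  rewrite /del_edges_adj /= mem_adj // !in_setU1 in_setD1 eqxx /= orbF negb_or.
  apply/andP; split; apply/eqP => /set2_eq [] [E1 E2].
  - by have := neq _ _ uU xM; rewrite E1 eqxx.
  - by have := neq _ _ uU zM; rewrite E2 eqxx.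
  - by have := neq _ _ vU xM; rewrite E1 eqxx.
  by have := neq _ _ vU zM; rewrite E2 eqxx.
have zx' : del_edges_adj M' z x by rewrite del_edges_sym.
have cr p q : p \in P -> q \notin P -> q != t -> e p q ->
    [set p; q] = [set u; x] \/ [set p; q] = [set v; z].
  move=> p1 q1 q2; move: (H p q p1 q1 q2); rewrite /e /del_edges_adj /= !in_setU1 in_setD1.
  case: (adj p q) => //=; rewrite negbK => /or3P [/eqP->|/eqP->|/andP [_ ->]] // _; by [left|right].
(* If ux did not cross the cut, vz alone would cross it in G - M and be critical. *)
have ux : exists p q, [/\ p \in P, q \notin P, q != t & [set p; q] = [set u; x]].
  case: (boolP [exists p, exists q, cross e P t p q && ([set p; q] == [set u; x])]).
    move=> /existsP [p /existsP [q /andP [/and4P [p1 q1 q2 _] /eqP E]]].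
    by exists p, q.
  move=> no; have : crit e v z.
    apply: (crit_of_cut eC c2 tP pP qP qt) => p q p1 q1 q2 epq.
    case: (cr p q p1 q1 q2 epq) => // E; case/negP: no.
    by apply/existsP; exists p; apply/existsP; exists q; rewrite E eqxx /cross p1 q1 q2 epq.
  by move: yv; rewrite inE => /andP [_ /negPf ->].
have vz : exists p q, [/\ p \in P, q \notin P, q != t & [set p; q] = [set v; z]].
  case: (boolP [exists p, exists q, cross e P t p q && ([set p; q] == [set v; z])]).
    move=> /existsP [p /existsP [q /andP [/and4P [p1 q1 q2 _] /eqP E]]].
    by exists p, q.
  move=> no; have : crit e u x.
    apply: (crit_of_cut eC c2 tP pP qP qt) => p q p1 q1 q2 epq.
    case: (cr p q p1 q1 q2 epq) => // E; case/negP: no.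
    by apply/existsP; exists p; apply/existsP; exists q; rewrite E eqxx /cross p1 q1 q2 epq.
  by move: xu; rewrite inE => /andP [_ /negPf ->].
have [p1 [q1 [p1P q1P q1t E1]]] := ux; have [p2 [q2 [p2P q2P q2t E2]]] := vz.
have zu : z != u by rewrite eq_sym neq.
have xv : x != v by rewrite eq_sym neq.
(* Since xz is an edge of G - M', x and z lie on the same side. This excludes the mixed cases; in
   one of the others the opposite side has to be taken. *)
case: (set2_eq E1) => -[? ?]; case: (set2_eq E2) => -[? ?]; subst p1 q1 p2 q2.
- exists (opp P t), t; rewrite !in_opp eqxx p1P p2P q1P q2P q1t q2t !andbF; split=> //.
    by split; apply: contraNneq tP => <-.
  move=> p q; rewrite !in_opp negb_and !negbK => /andP [pt p3] /orP [/eqP-> /eqP //|q3 _ epq].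
  case: (cr q p q3 p3 pt (etrans (eC _ _) epq)) => /set2_eq [] [Eq Ep]; subst; auto.
    by rewrite p1P in p3.
  by rewrite p2P in p3.
- by have := H z x p2P q1P q1t; rewrite zx'.
- by have := H x z p1P q2P q2t; rewrite xz'.
exists P, t; split=> // p q p3 q3 q3t epq.
case: (cr p q p3 q3 q3t epq) => /set2_eq [] [Ep Eq]; subst; auto.
  by rewrite p3 in q1P.
by rewrite p3 in q2P.
Qed.

Lemma matching_not_maximal : False.
Proof.
apply: (not_augmentable_absurd eC eI c2 partnerK not_e_partner d5 nbr_ge matched_le _ unmatched_crit swap_cut).
by rewrite -mul2n.
Qed.

End Augment.

Lemma removable_extend (G : sgraph) d (M : {set {set G}}) :
  4 < d -> 2 * d <= #|G| -> d <= min_degree G -> removable 2 M -> #|M| < d ->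
  exists M' : {set {set G}}, removable 2 M' /\ #|M'| = #|M|.+1.
Proof.
move=> d5 G_ge deg_ge remM M_lt.
case: (boolP [exists M' : {set {set G}}, removable 2 M' && (#|M'| == #|M|.+1)]).
  by move=> /existsP [M' /andP [rM' /eqP cM']]; exists M'.
move=> /existsPn H; exfalso.
apply: (matching_not_maximal d5 G_ge deg_ge remM M_lt) => M' sM' tM' cM'.
have := H M'; rewrite cM' eqxx andbT /removable /matching sM' tM' /=.
rewrite k_connected2E /= negb_and -leqNgt => /orP [le|//].
by have := leq_trans G_ge le; move: d5; clear; lia.
Qed.

(** * Complete graphs and the value of f *)

Definition complete_adj (n : nat) : rel 'I_n := fun x y => x != y.

Fact complete_sym n : symmetric (@complete_adj n).
Proof. by move=> x y; rewrite /complete_adj eq_sym. Qed.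

Fact complete_irr n : irreflexive (@complete_adj n).
Proof. by move=> x; rewrite /complete_adj eqxx. Qed.

Definition complete (n : nat) : sgraph := SGraph (@complete_sym n) (@complete_irr n).

Lemma complete_k_connected n k : k < n -> k_connected k (complete n).
Proof.
move=> kn; rewrite /k_connected card_ord kn /=; apply/forallP => S; apply/implyP => _.
apply/forallP => x; apply/forallP => y; have [->|xy] := eqVneq x y; first exact: connect0.
exact: connect1.
Qed.

Lemma complete_min_degree n m : m < n -> m <= min_degree (complete n).
Proof.
move=> mn; rewrite /min_degree; elim/big_ind: _ => [|p q mp mq|x _].
- by rewrite card_ord ltnW.
- by rewrite leq_min mp.
have -> : degree x = #|[set~ x]|.
  by apply: eq_card => y; rewrite !inE eq_sym.
by have := cardsC1 x; rewrite card_ord => ->; move: mn; case: n x.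
Qed.

Theorem corollary1p2 (d : nat) (hd : 5 <= d) : f_eq 2 d d.
Proof.
split=> [G kG G_ge deg_ge | m].
  (* Removable matchings of all sizes up to d arise from the empty one; each extension adds one to
     the size but may exchange edges. *)
  suff H m : m <= d -> exists M : {set {set G}}, removable 2 M /\ #|M| = m by exact: H.
  elim: m => [_|m IHm md].
    exists set0; rewrite cards0; split=> //; rewrite /removable /matching sub0set /=.
    apply/andP; split; first by apply/trivIsetP => A B; rewrite inE.
    rewrite k_connected2E in kG; rewrite k_connected2E /=; case/andP: kG => -> /=.
    move=> /conn2P H; apply/conn2P => P t x y tP xP yP yt.
    have [p [q [pP qP qt pq]]] := H P t x y tP xP yP yt.
    by exists p, q; split=> //; rewrite /del_edges_adj /= pq inE.
  have [M [rM cM]] := IHm (ltnW md).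
  have [|M' [rM' cM']] := removable_extend hd G_ge deg_ge rM; first by rewrite cM.
  by exists M'; rewrite cM' cM.
(* In the complete graph on 2d vertices, disjoint edges cover twice their number of vertices, so at
   most d of them fit. *)
move=> /(_ (complete (2 * d))) [|||M [/andP [/andP [ME MT] _] <-]].
- by apply: complete_k_connected; move: hd; clear; lia.
- by rewrite card_ord.
- by apply: complete_min_degree; move: hd; clear; lia.
have : #|cover M| <= 2 * d by apply: leq_trans (max_card _) _; rewrite card_ord.
rewrite -(eqP MT).
have -> : \sum_(B in M) #|B| = \sum_(B in M) 2.
  apply: eq_bigr => B /(subsetP ME); rewrite inE.
  move=> /existsP [p /existsP [q /andP [pq /eqP ->]]].
  by rewrite cards2; move: pq; rewrite /= /complete_adj => ->.
by rewrite sum_nat_const mulnC leq_pmul2l.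
Qed.
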